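(* Let $f(R,T)=f_1(R)+f_2(T)$, where $f_1,f_2$ are smooth real functions of one variable, and consider the corresponding $f(R,T)$ field equations for a perfect fluid, $$G_{\mu\nu}=\frac{1}{f_{1R}}\Big((8\pi+f_{2T})T_{\mu\nu}+f_{2T}\,p\,g_{\mu\nu}+\tfrac12 f_2\,g_{\mu\nu}+\tfrac12\,(f_1-f_{1R}R)\,g_{\mu\nu}-(g_{\mu\nu}\square-\nabla_\mu\nabla_\nu)f_{1R}\Big),$$ where $f_{1R}=df_1/dR$ and $f_{2T}=df_2/dT$. These field equations admit self-similar solutions (in the sense defined in the context) if and only if $f_1(R)=R^n$ and $f_2(T)=\lambda T$ for some $n,\lambda\in\mathbb{R}$.
   Context: Geometry: the spacetime metric is the flat FLRW metric $ds^2=-dt^2+a(t)^2(dx^2+dy^2+dz^2)$, $t>0$. $R$ is its Ricci scalar, $G_{\mu\nu}=R_{\mu\nu}-\frac12Rg_{\mu\nu}$ its Einstein tensor, $\nabla$ its Levi-Civita connection, and $\square=g^{\mu\nu}\nabla_\mu\nabla_\nu$. Matter: a perfect fluid with $T_{\mu\nu}=(\rho+p)u_\mu u_\nu+p\,g_{\mu\nu}$, $u=\partial_t$, $p=\omega\rho$ with $\omega$ a constant, and trace $T=-\rho+3p$. The quantities $\rho,p$ depend only on $t$. $f_2$ and $f_{2T}$ are evaluated at $T=T(t)$; $f_1$ and $f_{1R}$ are evaluated at $R=R(t)$. Self-similarity: the metric is self-similar with homothetic vector field $\mathcal{H}=t\partial_t+(1-a_1)(x\partial_x+y\partial_y+z\partial_z)$,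 i.e. $L_{\mathcal{H}}g_{\mu\nu}=2g_{\mu\nu}$, where $L$ is the Lie derivative and $a_1$ is a constant. Correspondingly $a(t)=t^{a_1}$ with $a_1>0$, and $R=R_0t^{-2}$ with $R_0=6a_1(2a_1-1)$. Definition: denote the right-hand side of the field equations by $T^{\mathrm{eff}}_{\mu\nu}$. The field equations ''admit self-similar solutions'' if the homothetic vector field is a matter collineation of $T^{\mathrm{eff}}_{\mu\nu}$, $L_{\mathcal{H}}T^{\mathrm{eff}}_{\mu\nu}=0$. This condition is imposed separately on each constituent of $T^{\mathrm{eff}}_{\mu\nu}$; with $F=f_{1R}$, the constituents are $$\tfrac12(F^{-1}f_1-R)g_{\mu\nu},\quad F^{-1}(\nabla_\mu\nabla_\nu-g_{\mu\nu}\square)F,\quad F^{-1}T_{\mu\nu},\quad F^{-1}f_{2T}T_{\mu\nu},\quad F^{-1}f_{2T}\,p\,g_{\mu\nu},\quad F^{-1}f_2\,g_{\mu\nu}.$$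
   Formalization: f_1(R)=R^n is corrected to f_1(R)=c R^n with c, n nonzero (|R|^n for R<0; value 0 at R=0), since f_1=2R, f_2=0, ρ=t^{-2} is self-similar; f_{1R}≠0 and a positive density ρ are required, and f_1, f_2 are determined only at the values taken by R and T. *)

(* Defs.v *)
(* Stdlib reals and Coquelicot. *)
From Stdlib Require Import Reals List.
From Coquelicot Require Import Coquelicot.
Import ListNotations.
Open Scope R_scope.

Inductive coord := ct | cx | cy | cz.

Definition coord_eq_dec (i j : coord) : {i = j} + {i <> j}.
Proof. decide equality. Defined.

Definition sum4 (f : coord -> R) : R := f ct + f cx + f cy + f cz.

(* The spacetime is the set of points p with 0 < p ct. *)
Definition point := coord -> R.
Definition scalar_field := point -> R.
Definition vector_field := point -> coord -> R.
Definition tensor2 := point -> coord -> coord -> R.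

Definition upd (p : point) (m : coord) (s : R) : point :=
  fun k => if coord_eq_dec k m then s else p k.

Definition partial (m : coord) (f : scalar_field) : scalar_field :=
  fun p => Derive (fun s => f (upd p m s)) (p m).

(* In the next definitions ginv stands for the inverse g^{mu nu} of the metric g. *)
Definition christoffel (g ginv : tensor2) (l m n : coord) : scalar_field :=
  fun p => / 2 * sum4 (fun s => ginv p l s *
    (partial m (fun q => g q s n) p + partial n (fun q => g q s m) p
     - partial s (fun q => g q m n) p)).

(* Sign convention: R_{mn} = d_l Gamma^l_{mn} - d_n Gamma^l_{ml} + ... *)
Definition ricci (g ginv : tensor2) : tensor2 := fun p m n =>
  sum4 (fun l => partial l (christoffel g ginv l m n) p
                 - partial n (christoffel g ginv l m l) p)
  + sum4 (fun l => sum4 (fun s =>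
      christoffel g ginv l l s p * christoffel g ginv s m n p
      - christoffel g ginv l n s p * christoffel g ginv s m l p)).

Definition ricci_scalar (g ginv : tensor2) : scalar_field :=
  fun p => sum4 (fun m => sum4 (fun n => ginv p m n * ricci g ginv p m n)).

(* nabla_m nabla_n F for a scalar F *)
Definition hessian (g ginv : tensor2) (F : scalar_field) : tensor2 :=
  fun p m n => partial m (partial n F) p
    - sum4 (fun l => christoffel g ginv l m n p * partial l F p).

Definition box (g ginv : tensor2) (F : scalar_field) : scalar_field :=
  fun p => sum4 (fun m => sum4 (fun n => ginv p m n * hessian g ginv F p m n)).

Definition lie (X : vector_field) (S : tensor2) : tensor2 := fun p m n =>
  sum4 (fun s => X p s * partial s (fun q => S q m n) p
     + S p s n * partial m (fun q => X q s) p
     + S p m s * partial n (fun q => X q s) p).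

Definition matter_collineation (X : vector_field) (S : tensor2) : Prop :=
  forall p : point, 0 < p ct -> forall m n : coord, lie X S p m n = 0.

Definition scale_factor (a1 t : R) : R := Rpower t a1.

Definition metric (a1 : R) : tensor2 := fun p m n =>
  match m, n with
  | ct, ct => -1
  | cx, cx | cy, cy | cz, cz => scale_factor a1 (p ct) ^ 2
  | _, _ => 0
  end.

Definition inv_metric (a1 : R) : tensor2 := fun p m n =>
  match m, n with
  | ct, ct => -1
  | cx, cx | cy, cy | cz, cz => / (scale_factor a1 (p ct) ^ 2)
  | _, _ => 0
  end.

Definition homothety (a1 : R) : vector_field := fun p m =>
  match m with
  | ct => p ct
  | _ => (1 - a1) * p m
  end.

Definition curvature (a1 : R) : scalar_field :=
  ricci_scalar (metric a1) (inv_metric a1).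

Definition four_velocity : vector_field := fun _ m =>
  match m with ct => 1 | _ => 0 end.

Definition lower (g : tensor2) (X : vector_field) : vector_field :=
  fun p m => sum4 (fun n => g p m n * X p n).

Definition pressure (w : R) (rho : R -> R) (t : R) : R := w * rho t.

Definition fluid (a1 w : R) (rho : R -> R) : tensor2 := fun p m n =>
  let u := lower (metric a1) four_velocity p in
  (rho (p ct) + pressure w rho (p ct)) * u m * u n
  + pressure w rho (p ct) * metric a1 p m n.

Definition trace (w : R) (rho : R -> R) (t : R) : R :=
  - rho t + 3 * pressure w rho t.

Definition F_of (f1 : R -> R) (a1 : R) : scalar_field :=
  fun p => Derive f1 (curvature a1 p).

Definition T_eff (f1 f2 : R -> R) (a1 w : R) (rho : R -> R) : tensor2 :=
  fun p m n =>
  let g := metric a1 in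
  let ginv := inv_metric a1 in
  let Rs := curvature a1 p in
  let F := F_of f1 a1 in
  let T := trace w rho (p ct) in
  / F p *
    ((8 * PI + Derive f2 T) * fluid a1 w rho p m n
     + Derive f2 T * pressure w rho (p ct) * g p m n
     + / 2 * f2 T * g p m n
     + / 2 * (f1 Rs - F p * Rs) * g p m n
     - (g p m n * box g ginv F p - hessian g ginv F p m n)).

Definition constituents (f1 f2 : R -> R) (a1 w : R) (rho : R -> R)
  : list tensor2 :=
  let g := metric a1 in
  let ginv := inv_metric a1 in
  let F := F_of f1 a1 in
  let T p := trace w rho (p ct) in
  [ (fun p m n => / 2 * (/ F p * f1 (curvature a1 p) - curvature a1 p) * g p m n);
    (fun p m n => / F p * (hessian g ginv F p m n - g p m n * box g ginv F p));
    (fun p m n => / F p * fluid a1 w rho p m n);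
    (fun p m n => / F p * Derive f2 (T p) * fluid a1 w rho p m n);
    (fun p m n => / F p * Derive f2 (T p) * pressure w rho (p ct) * g p m n);
    (fun p m n => / F p * f2 (T p) * g p m n) ].

Definition smooth_on (D : R -> Prop) (f : R -> R) : Prop :=
  forall (k : nat) (x : R), D x -> ex_derive_n f k x.

(* Where f1 is evaluated: the half-line of the sign of R_0 = 6 a1 (2 a1 - 1),
   or {0} when a1 = 1/2. *)
Definition curvature_values (a1 : R) (r : R) : Prop :=
  exists p : point, 0 < p ct /\ r = curvature a1 p.

(* Where f2 is evaluated: the values of - rho + 3 p for positive densities. *)
Definition trace_values (w : R) (T : R) : Prop :=
  exists s : R, 0 < s /\ T = - s + 3 * (w * s).

(* Existence of the density means existence of matter of the given equation of
   state that scales along with the geometry; G_{mn} = T_eff is not imposed. *)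
Definition admits_self_similar_solutions (f1 f2 : R -> R) (a1 w : R) : Prop :=
  exists rho : R -> R,
    smooth_on (fun t => 0 < t) rho /\
    (forall t : R, 0 < t -> 0 < rho t) /\
    matter_collineation (homothety a1) (T_eff f1 f2 a1 w rho) /\
    (forall S : tensor2, In S (constituents f1 f2 a1 w rho) ->
       matter_collineation (homothety a1) S).

(* Real power on one curvature half-line, up to a constant factor: for negative r
   and integer n it is r^n up to sign.  The value at 0 matters only for the
   curvature-free case a1 = 1/2 (Rpower 0 n would be 1). *)
Definition real_power (r n : R) : R :=
  if Req_EM_T r 0 then 0 else Rpower (Rabs r) n.

(* Main.v *)
Require Import Defs.
From Stdlib Require Import Reals Lra List.
From Coquelicot Require Import Coquelicot.
Open Scope R_scope.

(* For a tensor whose time component depends only on t, the tt component of the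
   collineation equation is the Euler equation t u' + 2 u = 0, so u is a multiple
   of t^-2.  Write R = R_0 / t^2.  For the first constituent this gives
   f_1 = R f_1' / n, hence f_1 = c |R|^n and f_1' ~ t^(2 - 2n).  The third then
   gives rho ~ f_1' t^-2 ~ t^(-2n), so rho takes all positive values; the sixth
   gives f_2(T) ~ f_1' t^-2 ~ rho, which is linear in T = (3w - 1) rho.  If w = 1/3,
   then T = 0 and f_2(0) ~ rho forces f_2(0) = 0.  If R_0 = 0, then f_1' is constant
   along the solution and rho ~ t^-2.  Conversely, the density t^(-2n) (or t^-2 when
   R_0 = 0) makes every constituent t^-2 times a constant diagonal rescaling of the
   metric, and T_eff is a combination of the constituents. *)

(** * Calculus on the half-line t > 0: real powers, Euler's equation, fields that depend only on
    time *)

Lemma locally_pos (t : R) : 0 < t -> locally t (fun s => 0 < s).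
Proof. intros ht; exact (open_gt 0 t ht). Qed.

Lemma Derive_ext_pos (f g : R -> R) (t : R) :
  0 < t -> (forall s, 0 < s -> f s = g s) -> Derive f t = Derive g t.
Proof.
  intros ht e; apply Derive_ext_loc.
  apply filter_imp with (2 := locally_pos t ht); exact e.
Qed.

Lemma ex_derive_ext_pos (f g : R -> R) (t : R) :
  0 < t -> (forall s, 0 < s -> f s = g s) -> ex_derive f t -> ex_derive g t.
Proof.
  intros ht e; apply ex_derive_ext_loc.
  apply filter_imp with (2 := locally_pos t ht); exact e.
Qed.

Lemma Rpower_pos (t b : R) : 0 < Rpower t b.
Proof. apply exp_pos. Qed.

Lemma Rpower_minus1 (t b : R) : 0 < t -> Rpower t (b - 1) = Rpower t b / t.
Proof.
  intros ht; unfold Rminus; rewrite Rpower_plus, Rpower_Ropp, Rpower_1 by exact ht.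
  reflexivity.
Qed.

Lemma Rpower_minus2 (t b : R) : 0 < t -> Rpower t (b - 2) = Rpower t b / t ^ 2.
Proof.
  intros ht; replace (b - 2) with (b - 1 - 1) by ring.
  rewrite !Rpower_minus1 by exact ht; field; lra.
Qed.

Lemma is_derive_Rpower (b t : R) :
  0 < t -> is_derive (fun s => Rpower s b) t (b * Rpower t (b - 1)).
Proof.
  intros ht; rewrite Rpower_minus1 by exact ht; unfold Rpower.
  auto_derive; [exact ht | field; lra].
Qed.

(** The constant is the falling factorial b (b - 1) ... (b - k + 1). Smoothness of the power-law
    density needs only that some constant exists. *)
Lemma Derive_n_Rpower (b : R) (k : nat) :
  exists c, forall t, 0 < t ->
    Derive_n (fun s => Rpower s b) k t = c * Rpower t (b - INR k).
Proof.
  induction k as [|k [c IH]].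
  - exists 1; intros t ht; simpl; rewrite Rminus_0_r; ring.
  - exists (c * (b - INR k)); intros t ht; rewrite S_INR; simpl Derive_n.
    rewrite (Derive_ext_pos _ _ t ht IH).
    replace (b - (INR k + 1)) with (b - INR k - 1) by ring.
    apply is_derive_unique; rewrite Rmult_assoc.
    apply is_derive_scal, is_derive_Rpower, ht.
Qed.

Lemma smooth_on_Rpower (b : R) : smooth_on (fun t => 0 < t) (fun t => Rpower t b).
Proof.
  intros [|k] t ht; [exact I|]; simpl.
  destruct (Derive_n_Rpower b k) as [c hc].
  apply (ex_derive_ext_pos (fun s => c * Rpower s (b - INR k))); [exact ht| |].
  - intros s hs; symmetry; apply hc, hs.
  - apply ex_derive_scal; eexists; apply is_derive_Rpower, ht.
Qed.

Lemma smooth_on_ex_derive (D : R -> Prop) (f : R -> R) (x : R) :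
  smooth_on D f -> D x -> ex_derive f x.
Proof. intros h hx; exact (h 1%nat x hx). Qed.

Lemma smooth_on_ex_derive_Derive (D : R -> Prop) (f : R -> R) (x : R) :
  smooth_on D f -> D x -> ex_derive (Derive f) x.
Proof. intros h hx; exact (h 2%nat x hx). Qed.

Lemma constant_of_derive_zero (h : R -> R) :
  (forall t, 0 < t -> is_derive h t 0) -> forall t, 0 < t -> h t = h 1.
Proof.
  intros hd t ht.
  destruct (MVT_gen h 1 t (fun _ => 0)) as [c [_ hc]].
  - intros x [hx _]; apply hd.
    apply Rlt_trans with (2 := hx), Rmin_glb_lt; lra.
  - intros x [hx _].
    apply derivable_continuous_pt; exists 0; apply is_derive_Reals, hd.
    apply Rlt_le_trans with (2 := hx), Rmin_glb_lt; lra.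
  - lra.
Qed.

(** Integrating factor: the equation makes the derivative of h(t) t^(-b) vanish, so this product
    keeps its value at t = 1. *)
Lemma euler_ode (h : R -> R) (b : R) :
  (forall t, 0 < t -> ex_derive h t) ->
  (forall t, 0 < t -> t * Derive h t = b * h t) ->
  forall t, 0 < t -> h t = h 1 * Rpower t b.
Proof.
  intros hd he t ht.
  assert (hc : forall s, 0 < s ->
    is_derive (fun r => h r * Rpower r (- b)) s 0).
  { intros s hs.
    replace 0 with (Derive h s * Rpower s (- b) + h s * (- b * Rpower s (- b - 1))).
    - apply (is_derive_mult (K := R_AbsRing) h (fun r => Rpower r (- b))).
      + apply Derive_correct, hd, hs.
      + apply is_derive_Rpower, hs.
      + intros; apply Rmult_comm.
    - rewrite Rpower_minus1 by exact hs.
      replace (Derive h s) with (b * h s / s) by (rewrite <- he by exact hs; field; lra).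
      field; lra. }
  pose proof (constant_of_derive_zero _ hc t ht) as e; simpl in e.
  rewrite Rpower_Ropp in e.
  replace (Rpower 1 (- b)) with 1 in e
    by (unfold Rpower; rewrite ln_1, Rmult_0_r, exp_0; reflexivity).
  pose proof (Rpower_pos t b).
  rewrite Rmult_1_r in e; rewrite <- e; field; lra.
Qed.

Lemma inverse_square_of_ode (u : R -> R) :
  (forall t, 0 < t -> ex_derive u t) ->
  (forall t, 0 < t -> t * Derive u t + 2 * u t = 0) ->
  forall t, 0 < t -> u t = u 1 / t ^ 2.
Proof.
  intros hd he t ht.
  (* The exponent is written [0 - 2] so that the power splits as t^0 / t^2. *)
  rewrite (euler_ode u (0 - 2)) with (t := t); [|exact hd| |exact ht].
  - rewrite Rpower_minus2, Rpower_O by exact ht; field; lra.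
  - intros s hs; specialize (he s hs); lra.
Qed.

(** Agreement on t > 0 suffices because the half-line is open. In a spatial direction [upd] keeps
    the time coordinate, so a constant function is differentiated. *)
Lemma partial_time (u : R -> R) (f : scalar_field) (m : coord) (p : point) :
  0 < p ct -> (forall q, 0 < q ct -> f q = u (q ct)) ->
  partial m f p = match m with ct => Derive u (p ct) | _ => 0 end.
Proof.
  intros hp e; unfold partial; destruct m.
  1: apply Derive_ext_pos; [exact hp | intros s hs; rewrite e; [reflexivity | exact hs]].
  all: rewrite (Derive_ext _ (fun _ => u (p ct)));
    [apply Derive_const | intros s; refine (e (upd p _ s) _); exact hp].
Qed.

(** * Christoffel symbols, curvature, Hessian and box of the flat FLRW metric *)

Lemma is_derive_scale_sq (a1 t : R) :
  0 < t -> is_derive (fun s => scale_factor a1 s ^ 2) t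
             (2 * a1 / t * scale_factor a1 t ^ 2).
Proof.
  intros ht; unfold scale_factor, Rpower.
  auto_derive; [exact ht | field; lra].
Qed.

Lemma scale_pos (a1 t : R) : 0 < scale_factor a1 t.
Proof. apply exp_pos. Qed.

(** Here a1 / t is the Hubble rate a'/a, and a1 / t * a^2 is a a'. *)
Definition flrw_christoffel (a1 : R) (l m n : coord) (t : R) : R :=
  match l, m, n with
  | ct, cx, cx | ct, cy, cy | ct, cz, cz => a1 / t * scale_factor a1 t ^ 2
  | cx, ct, cx | cx, cx, ct | cy, ct, cy | cy, cy, ct
  | cz, ct, cz | cz, cz, ct => a1 / t
  | _, _, _ => 0
  end.

Definition metric_dot (a1 : R) (m n : coord) (t : R) : R :=
  match m, n with
  | cx, cx | cy, cy | cz, cz => 2 * a1 / t * scale_factor a1 t ^ 2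
  | _, _ => 0
  end.

Lemma partial_metric (a1 : R) (k m n : coord) (p : point) :
  0 < p ct -> partial k (fun q => metric a1 q m n) p =
    match k with ct => metric_dot a1 m n (p ct) | _ => 0 end.
Proof.
  intros hp.
  (* The constant point with all coordinates t serves to read a metric component as a function of
     time alone. *)
  rewrite (partial_time (fun t => metric a1 (fun _ => t) m n))
    by (exact hp || (intros q _; destruct m, n; reflexivity)).
  destruct k; try reflexivity.
  destruct m, n; simpl metric; simpl metric_dot; try apply Derive_const;
    apply is_derive_unique, is_derive_scale_sq, hp.
Qed.

Lemma christoffel_flrw (a1 : R) (l m n : coord) (p : point) :
  0 < p ct ->
  christoffel (metric a1) (inv_metric a1) l m n p = flrw_christoffel a1 l m n (p ct).
Proof.
  intros hp; unfold christoffel, sum4.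
  rewrite !partial_metric by exact hp.
  pose proof (scale_pos a1 (p ct)).
  destruct l, m, n; simpl inv_metric; simpl metric_dot; simpl flrw_christoffel;
    field; try (split; apply Rgt_not_eq; assumption); lra.
Qed.

(** The factor 2 a1 - 1 comes from a a' = a1 t^(2 a1 - 1). *)
Definition flrw_christoffel_dot (a1 : R) (l m n : coord) (t : R) : R :=
  match l, m, n with
  | ct, cx, cx | ct, cy, cy | ct, cz, cz =>
      (2 * a1 - 1) * a1 / t ^ 2 * scale_factor a1 t ^ 2
  | cx, ct, cx | cx, cx, ct | cy, ct, cy | cy, cy, ct
  | cz, ct, cz | cz, cz, ct => - a1 / t ^ 2
  | _, _, _ => 0
  end.

Lemma partial_christoffel (a1 : R) (k l m n : coord) (p : point) :
  0 < p ct -> partial k (christoffel (metric a1) (inv_metric a1) l m n) p =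
    match k with ct => flrw_christoffel_dot a1 l m n (p ct) | _ => 0 end.
Proof.
  intros hp.
  rewrite (partial_time (flrw_christoffel a1 l m n))
    by (exact hp || (intros q; apply christoffel_flrw)).
  destruct k; try reflexivity.
  assert (h1 : Derive (fun t => a1 / t) (p ct) = - a1 / p ct ^ 2).
  { apply is_derive_unique; auto_derive; [lra | field; lra]. }
  assert (h2 : Derive (fun t => a1 / t * scale_factor a1 t ^ 2) (p ct)
    = (2 * a1 - 1) * a1 / p ct ^ 2 * scale_factor a1 (p ct) ^ 2).
  { apply is_derive_unique; unfold scale_factor, Rpower.
    auto_derive; [repeat split; lra | field; lra]. }
  destruct l, m, n; simpl flrw_christoffel_dot; unfold flrw_christoffel;
    try apply Derive_const; assumption.
Qed.

(** This is R = 6 (a''/a + (a'/a)^2) for a = t^a1, that is 6 (a1 (a1 - 1) + a1^2) / t^2. *)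
Lemma curvature_flrw (a1 : R) (p : point) :
  0 < p ct -> curvature a1 p = 6 * a1 * (2 * a1 - 1) / p ct ^ 2.
Proof.
  intros hp; unfold curvature, ricci_scalar, sum4; simpl inv_metric.
  (* The off-diagonal terms are removed before [ricci] is unfolded, so only four components get
     expanded. *)
  rewrite !Rmult_0_l; unfold ricci, sum4.
  rewrite !partial_christoffel, !christoffel_flrw by exact hp.
  pose proof (scale_pos a1 (p ct)).
  simpl flrw_christoffel; simpl flrw_christoffel_dot.
  field; split; apply Rgt_not_eq; assumption.
Qed.

Lemma hessian_flrw (a1 : R) (phi : R -> R) (F : scalar_field) (p : point) (m n : coord) :
  0 < p ct -> (forall q, 0 < q ct -> F q = phi (q ct)) ->
  hessian (metric a1) (inv_metric a1) F p m n =
    match m, n with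
    | ct, ct => Derive (Derive phi) (p ct)
    | cx, cx | cy, cy | cz, cz =>
        - (a1 / p ct * Derive phi (p ct)) * metric a1 p m n
    | _, _ => 0
    end.
Proof.
  intros hp e; unfold hessian, sum4.
  rewrite !christoffel_flrw, !(partial_time phi F) by assumption.
  (* The first derivative of F is again a function of time alone: phi' in the time direction, 0 in
     the others. *)
  rewrite (partial_time (match n with ct => Derive phi | _ => fun _ => 0 end))
    by (exact hp || (intros q hq; rewrite (partial_time phi F) by assumption;
                     destruct n; reflexivity)).
  destruct m, n; simpl flrw_christoffel; simpl metric; try rewrite Derive_const; ring.
Qed.

Lemma box_flrw (a1 : R) (phi : R -> R) (F : scalar_field) (p : point) :
  0 < p ct -> (forall q, 0 < q ct -> F q = phi (q ct)) ->
  box (metric a1) (inv_metric a1) F p =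
    - Derive (Derive phi) (p ct) - 3 * (a1 / p ct * Derive phi (p ct)).
Proof.
  intros hp e; unfold box, sum4; rewrite !(hessian_flrw a1 phi) by assumption.
  pose proof (scale_pos a1 (p ct)).
  simpl inv_metric; simpl metric; field; split; apply Rgt_not_eq; assumption.
Qed.

(** * Collineations along the homothety, and inverse-square tensors *)

Lemma partial_homothety (a1 : R) (m s : coord) (p : point) :
  partial m (fun q => homothety a1 q s) p =
    if coord_eq_dec m s then match m with ct => 1 | _ => 1 - a1 end else 0.
Proof.
  unfold partial.
  destruct m, s; simpl; unfold upd; simpl; try apply Derive_const; try apply Derive_id;
    apply is_derive_unique; auto_derive; try exact I; ring.
Qed.

(** The spatial components of the homothety do not depend on t, and S_tt does not depend on space,
    so L_H S = 0 has tt component t u' + 2 u = 0. *)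
Lemma collineation_time_component (a1 : R) (S : tensor2) (u : R -> R) :
  matter_collineation (homothety a1) S ->
  (forall p, 0 < p ct -> S p ct ct = u (p ct)) ->
  (forall t, 0 < t -> ex_derive u t) ->
  exists k, forall t, 0 < t -> u t = k / t ^ 2.
Proof.
  intros hS e hd; exists (u 1); apply inverse_square_of_ode; [exact hd|].
  intros t ht; pose proof (hS (fun _ => t) ht ct ct) as h.
  unfold lie, sum4 in h; rewrite !partial_homothety in h.
  rewrite !(partial_time u (fun q => S q ct ct)) in h by assumption.
  rewrite e in h by exact ht; simpl in h.
  lra.
Qed.

(** Time and space carry separate constants, so that the fluid and Hessian tensors fit as well as
    multiples of the metric. Off the diagonal the metric factor forces S to vanish. *)
Definition inverse_square (a1 : R) (S : tensor2) : Prop :=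
  exists c d : R, forall p : point, 0 < p ct -> forall m n : coord,
    S p m n = match m, n with
              | ct, ct => c / p ct ^ 2
              | _, _ => d / p ct ^ 2 * metric a1 p m n
              end.

(** The tt equation is the Euler equation for c / t^2. A spatial diagonal entry is d t^(2 a1 - 2),
    and t d/dt yields the factor 2 a1 - 2, which cancels 2 (1 - a1) from the homothety. *)
Lemma inverse_square_collineation (a1 : R) (S : tensor2) :
  inverse_square a1 S -> matter_collineation (homothety a1) S.
Proof.
  intros [c [d e]] p hp m n; unfold lie, sum4.
  rewrite !partial_homothety.
  rewrite !(partial_time (fun t => match m, n with
              | ct, ct => c / t ^ 2
              | _, _ => d / t ^ 2 * metric a1 (fun _ => t) m n
              end)) by (exact hp || (intros q hq; rewrite e by exact hq;
                                     destruct m, n; reflexivity)).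
  rewrite !e by exact hp.
  destruct m, n; simpl.
  all: try (rewrite (Derive_ext _ (fun _ => 0)) by (intros; ring);
            rewrite Derive_const; ring).
  - replace (Derive _ _) with (- (2 * c / p ct ^ 3)).
    + field; lra.
    + symmetry; apply is_derive_unique; auto_derive; [nra | field; lra].
  all: replace (Derive _ _)
    with ((2 * a1 - 2) * d / p ct ^ 3 * scale_factor a1 (p ct) ^ 2);
    [field; lra|].
  all: symmetry; apply is_derive_unique; unfold scale_factor, Rpower.
  all: auto_derive; [split; [nra | lra] | field; lra].
Qed.

Lemma inverse_square_add (a1 : R) (S S' : tensor2) :
  inverse_square a1 S -> inverse_square a1 S' ->
  inverse_square a1 (fun p m n => S p m n + S' p m n).
Proof.
  intros [c [d e]] [c' [d' e']]; exists (c + c'), (d + d'); intros p hp m n.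
  rewrite e, e' by exact hp; destruct m, n; field; lra.
Qed.

Lemma inverse_square_scal (a1 k : R) (S : tensor2) :
  inverse_square a1 S -> inverse_square a1 (fun p m n => k * S p m n).
Proof.
  intros [c [d e]]; exists (k * c), (k * d); intros p hp m n.
  rewrite e by exact hp; destruct m, n; field; lra.
Qed.

Lemma inverse_square_ext (a1 : R) (S S' : tensor2) :
  (forall p, 0 < p ct -> forall m n, S' p m n = S p m n) ->
  inverse_square a1 S -> inverse_square a1 S'.
Proof.
  intros h [c [d e]]; exists c, d; intros p hp m n.
  rewrite h by exact hp; apply e, hp.
Qed.

Lemma inverse_square_metric (a1 k : R) (phi : scalar_field) :
  (forall p, 0 < p ct -> phi p = k / p ct ^ 2) ->
  inverse_square a1 (fun p m n => phi p * metric a1 p m n).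
Proof.
  intros h; exists (- k), k; intros p hp m n.
  rewrite h by exact hp; destruct m, n; simpl metric; field; lra.
Qed.

(** * The constituents when F is a power of t *)

Lemma fluid_flrw (a1 w : R) (rho : R -> R) (p : point) (m n : coord) :
  fluid a1 w rho p m n =
    match m, n with
    | ct, ct => rho (p ct)
    | _, _ => w * rho (p ct) * metric a1 p m n
    end.
Proof.
  unfold fluid, lower, pressure, sum4.
  destruct m, n; simpl metric; simpl four_velocity; ring.
Qed.

Lemma inverse_square_fluid (a1 w k : R) (rho : R -> R) (phi : scalar_field) :
  (forall p, 0 < p ct -> phi p * rho (p ct) = k / p ct ^ 2) ->
  inverse_square a1 (fun p m n => phi p * fluid a1 w rho p m n).
Proof.
  intros h; exists k, (w * k); intros p hp m n; rewrite fluid_flrw.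
  replace (w * k / p ct ^ 2) with (w * (phi p * rho (p ct)))
    by (rewrite h by exact hp; field; lra).
  destruct m, n; rewrite <- ?h by exact hp; ring.
Qed.

Lemma inverse_square_hessian (a1 b k : R) (F : scalar_field) :
  k <> 0 -> (forall p, 0 < p ct -> F p = k * Rpower (p ct) b) ->
  inverse_square a1 (fun p m n =>
    / F p * (hessian (metric a1) (inv_metric a1) F p m n
             - metric a1 p m n * box (metric a1) (inv_metric a1) F p)).
Proof.
  intros hk e.
  assert (d1 : forall t, 0 < t ->
    Derive (fun s => k * Rpower s b) t = k * b * Rpower t (b - 1)).
  { intros t ht; apply is_derive_unique; rewrite Rmult_assoc.
    apply is_derive_scal, is_derive_Rpower, ht. }
  assert (d2 : forall t, 0 < t ->
    Derive (Derive (fun s => k * Rpower s b)) t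
      = k * b * ((b - 1) * Rpower t (b - 1 - 1))).
  { intros t ht; rewrite (Derive_ext_pos _ _ t ht d1).
    apply is_derive_unique, is_derive_scal, is_derive_Rpower, ht. }
  (* In the tt component F'' cancels against the box and -3 (a1/t) F' remains; the spatial factor is
     F'' + 2 (a1/t) F'. Division by F = k t^b gives the two constants. *)
  exists (- 3 * a1 * b), (b * (b - 1) + 2 * a1 * b); intros p hp m n.
  rewrite (box_flrw a1 (fun s => k * Rpower s b)) by assumption.
  rewrite (hessian_flrw a1 (fun s => k * Rpower s b)) by assumption.
  rewrite d2, d1, e, !Rpower_minus1 by exact hp.
  pose proof (Rpower_pos (p ct) b).
  destruct m, n; simpl metric; field; repeat split; lra.
Qed.

(* The density is t^(b-2), the only choice up to a constant, because rho / F has to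
   be a multiple of t^-2. *)
Lemma power_law_admits (f1 f2 : R -> R) (a1 w b k c l l' : R) :
  k <> 0 ->
  (forall p, 0 < p ct -> F_of f1 a1 p = k * Rpower (p ct) b) ->
  (forall p, 0 < p ct -> f1 (curvature a1 p) = c * Rpower (p ct) (b - 2)) ->
  (forall s, 0 < s -> f2 (- s + 3 * (w * s)) = l * s) ->
  (forall s, 0 < s -> Derive f2 (- s + 3 * (w * s)) = l') ->
  admits_self_similar_solutions f1 f2 a1 w.
Proof.
  intros hk hF h1 h2 h2'; exists (fun t => Rpower t (b - 2)).
  set (rho := fun t => Rpower t (b - 2)).
  assert (hrho : forall t, 0 < rho t) by (intros; apply Rpower_pos).
  (* Apart from the Hessian one, every constituent reduces to this ratio, because f_1, f_2 and p are
     all constant multiples of rho along the solution. *)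
  assert (hrF : forall p, 0 < p ct -> / F_of f1 a1 p * rho (p ct) = / k / p ct ^ 2).
  { intros p hp; rewrite hF by exact hp; unfold rho; rewrite Rpower_minus2 by exact hp.
    pose proof (Rpower_pos (p ct) b); field; repeat split; lra. }
  assert (hS : forall S, In S (constituents f1 f2 a1 w rho) -> inverse_square a1 S).
  { intros S [<- | [<- | [<- | [<- | [<- | [<- | []]]]]]].
    - apply (inverse_square_metric a1 (/ 2 * (c / k - 6 * a1 * (2 * a1 - 1)))).
      intros p hp; rewrite h1 by exact hp; fold (rho (p ct)).
      replace (/ F_of f1 a1 p * (c * rho (p ct)))
        with (c * (/ F_of f1 a1 p * rho (p ct))) by ring.
      rewrite hrF, curvature_flrw by exact hp; field; lra.
    - exact (inverse_square_hessian a1 b k _ hk hF).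
    - exact (inverse_square_fluid a1 w (/ k) rho _ hrF).
    - apply (inverse_square_fluid a1 w (l' * / k) rho).
      intros p hp; unfold trace, pressure; rewrite h2' by apply hrho.
      transitivity (l' * (/ F_of f1 a1 p * rho (p ct))); [ring|].
      rewrite hrF by exact hp; field; lra.
    - apply (inverse_square_metric a1 (l' * w * / k)).
      intros p hp; unfold trace, pressure; rewrite h2' by apply hrho.
      transitivity (l' * w * (/ F_of f1 a1 p * rho (p ct))); [ring|].
      rewrite hrF by exact hp; field; lra.
    - apply (inverse_square_metric a1 (l * / k)).
      intros p hp; unfold trace, pressure; rewrite h2 by apply hrho.
      transitivity (l * (/ F_of f1 a1 p * rho (p ct))); [ring|].
      rewrite hrF by exact hp; field; lra. }
  split; [apply smooth_on_Rpower|].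
  split; [intros t _; apply hrho|].
  split; [|intros S hin; apply inverse_square_collineation, hS, hin].
  apply inverse_square_collineation.
  pose proof (hS _ (or_introl eq_refl)) as i1.
  pose proof (hS _ (or_intror (or_introl eq_refl))) as i2.
  pose proof (hS _ (or_intror (or_intror (or_introl eq_refl)))) as i3.
  pose proof (hS _ (or_intror (or_intror (or_intror (or_introl eq_refl))))) as i4.
  pose proof (hS _ (or_intror (or_intror (or_intror (or_intror
    (or_introl eq_refl)))))) as i5.
  pose proof (hS _ (or_intror (or_intror (or_intror (or_intror (or_intror
    (or_introl eq_refl))))))) as i6.
  (* [T_eff] is the sum of the constituents with weights 1, 1, 8 pi, 1, 1, 1/2. Matching the first
     one uses F <> 0, to turn F^(-1) (f_1 - F R) into F^(-1) f_1 - R. *)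
  refine (inverse_square_ext a1 _ _ _
    (inverse_square_add a1 _ _ i1 (inverse_square_add a1 _ _ i2
    (inverse_square_add a1 _ _ (inverse_square_scal a1 (8 * PI) _ i3)
    (inverse_square_add a1 _ _ i4 (inverse_square_add a1 _ _ i5
       (inverse_square_scal a1 (/ 2) _ i6))))))).
  intros p hp m n; unfold T_eff; cbv beta zeta.
  assert (F_of f1 a1 p <> 0).
  { rewrite hF by exact hp; pose proof (Rpower_pos (p ct) b).
    apply Rmult_integral_contrapositive_currified; lra. }
  field; assumption.
Qed.

(** * Power laws for f_1 along the curve R = r / t^2 *)

Lemma real_power_inverse_square (r n t : R) :
  r <> 0 -> 0 < t ->
  real_power (r / t ^ 2) n = Rpower (Rabs r) n * Rpower t (- 2 * n).
Proof.
  intros hr ht; unfold real_power.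
  assert (h : 0 < / t ^ 2) by (apply Rinv_0_lt_compat; nra).
  assert (hr' : 0 < Rabs r) by (apply Rabs_pos_lt, hr).
  destruct (Req_EM_T (r / t ^ 2) 0) as [e|_].
  - exfalso; apply Rmult_integral in e; lra.
  - unfold Rdiv; rewrite Rabs_mult, (Rabs_pos_eq (/ t ^ 2)) by lra.
    rewrite <- Rpower_mult_distr by assumption; f_equal.
    replace (/ t ^ 2) with (Rpower t (- 2)).
    + apply Rpower_mult.
    + replace (- 2) with (- INR 2) by (simpl; ring).
      rewrite Rpower_Ropp; f_equal; apply Rpower_pow, ht.
Qed.

Lemma is_derive_inverse_square (r t : R) :
  0 < t -> is_derive (fun s => r / s ^ 2) t (- 2 * r / t ^ 3).
Proof. intros ht; auto_derive; [nra | field; lra]. Qed.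

Lemma is_derive_along_inverse_square (f : R -> R) (r t : R) :
  0 < t -> ex_derive f (r / t ^ 2) ->
  is_derive (fun s => f (r / s ^ 2)) t (- 2 * r / t ^ 3 * Derive f (r / t ^ 2)).
Proof.
  intros ht hd.
  apply (is_derive_comp f (fun s => r / s ^ 2)).
  - apply Derive_correct, hd.
  - apply is_derive_inverse_square, ht.
Qed.

(** The law for f is given along the curve s -> r / s^2. Differentiating there by the chain rule and
    dividing by the nonzero speed -2 r / t^3 recovers f'. *)
Lemma Derive_of_power_law (f : R -> R) (r c n t : R) :
  r <> 0 -> 0 < t -> ex_derive f (r / t ^ 2) ->
  (forall s, 0 < s -> f (r / s ^ 2) = c * Rpower s (- 2 * n)) ->
  Derive f (r / t ^ 2) = c * n / r * Rpower t (2 - 2 * n).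
Proof.
  intros hr ht hd e.
  assert (h : - 2 * r / t ^ 3 * Derive f (r / t ^ 2)
              = c * (- 2 * n * Rpower t (- 2 * n - 1))).
  { transitivity (Derive (fun s => f (r / s ^ 2)) t).
    - symmetry; apply is_derive_unique, is_derive_along_inverse_square; assumption.
    - rewrite (Derive_ext_pos _ _ t ht e).
      apply is_derive_unique, is_derive_scal, is_derive_Rpower, ht. }
  replace (- 2 * n - 1) with (2 - 2 * n - 2 - 1) in h by ring.
  rewrite Rpower_minus1, Rpower_minus2 in h by exact ht.
  replace (Derive f (r / t ^ 2)) with (- t ^ 3 / (2 * r) *
    (- 2 * r / t ^ 3 * Derive f (r / t ^ 2))) by (field; split; lra).
  rewrite h; field; split; lra.
Qed.

(* The first constituent says that f/f' is proportional to the curvature. *)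
Lemma power_law_of_first_constituent (f : R -> R) (r k : R) :
  r <> 0 ->
  (forall t, 0 < t -> ex_derive f (r / t ^ 2)) ->
  (forall t, 0 < t -> Derive f (r / t ^ 2) <> 0) ->
  (forall t, 0 < t -> f (r / t ^ 2) = k / t ^ 2 * Derive f (r / t ^ 2)) ->
  exists c n, c <> 0 /\ n <> 0 /\
    forall t, 0 < t -> f (r / t ^ 2) = c * Rpower t (- 2 * n).
Proof.
  intros hr hd hF e.
  pose proof (fun t ht => is_derive_along_inverse_square f r t ht (hd t ht)) as hf.
  assert (hk : k <> 0).
  (* If k were 0, f would vanish along the whole curve, and the chain rule would force f' = 0. *)
  { intros ->; pose proof (is_derive_unique _ _ _ (hf 1 Rlt_0_1)) as h; simpl in h.
    rewrite (Derive_ext_pos _ (fun _ => 0)), Derive_const in h; [|lra|].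
    - specialize (hF 1 Rlt_0_1); simpl in hF.
      symmetry in h; apply Rmult_integral in h; destruct h as [h|h]; [lra | exact (hF h)].
    - intros s hs; pose proof (e s hs) as es; simpl in es; rewrite es.
      unfold Rdiv; ring. }
  (* From t d/dt f(r/t^2) = -2 (r/t^2) f' and f = (k/t^2) f', the Euler exponent is -2 r/k. The
     coefficient is the value at t = 1, kept in the form that [euler_ode] produces. *)
  exists (f (r / 1 ^ 2)), (r / k); split; [|split].
  - rewrite e by lra; apply Rmult_integral_contrapositive_currified; [|apply hF; lra].
    lra.
  - apply Rmult_integral_contrapositive_currified; [exact hr|].
    apply Rinv_neq_0_compat, hk.
  - intros t ht.
    apply (euler_ode (fun s => f (r / s ^ 2)) (- 2 * (r / k))); [| |exact ht].
    + intros s hs; eexists; apply hf, hs.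
    + intros s hs; transitivity (s * (- 2 * r / s ^ 3 * Derive f (r / s ^ 2))).
      { f_equal; apply is_derive_unique, hf, hs. }
      rewrite e by exact hs; field; split; lra.
Qed.

(** * Linearity of f_2 on the trace values *)

Lemma linear_of_power_density (f2 rho : R -> R) (w m K l : R) :
  m <> 0 -> 0 < K ->
  (forall t, 0 < t -> rho t = K * Rpower t m) ->
  (forall t, 0 < t -> f2 (trace w rho t) = l * rho t) ->
  exists lambda, forall T, trace_values w T -> f2 T = lambda * T.
Proof.
  intros hm hK hrho e.
  assert (hs : forall s, 0 < s -> f2 (- s + 3 * (w * s)) = l * s).
  (* The density takes the value s at time (s/K)^(1/m); here m <> 0 is essential. *)
  { intros s hs; specialize (e (Rpower (s / K) (/ m)) (Rpower_pos _ _)).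
    unfold trace, pressure in e.
    rewrite hrho, Rpower_mult, Rinv_l, Rpower_1 in e; trivial.
    - replace (K * (s / K)) with s in e by (field; lra); exact e.
    - apply Rdiv_lt_0_compat; assumption.
    - apply Rpower_pos. }
  destruct (Req_dec (3 * w - 1) 0) as [hw|hw].
  (* For w = 1/3 the densities s and 2 s have the same trace 0, so l s = 2 l s and f_2 vanishes
     there. *)
  - exists 0; intros T [s [hs0 ->]].
    pose proof (hs s hs0) as h1; pose proof (hs (2 * s) ltac:(lra)) as h2.
    replace (- (2 * s) + 3 * (w * (2 * s))) with (- s + 3 * (w * s)) in h2.
    + lra.
    + transitivity (2 * s * (3 * w - 1)); [|ring].
      transitivity (s * (3 * w - 1)); [ring|]; rewrite hw; ring.
  - exists (l / (3 * w - 1)); intros T [s [hs0 ->]].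
    rewrite hs by exact hs0; field; exact hw.
Qed.

(** For w = 1/3 the only trace value is 0, where linearity says nothing about f_2'; the derivative
    is still one fixed number, so l may differ from lambda. Otherwise the chain rule in s gives l =
    lambda. *)
Lemma Derive_of_linear (f2 : R -> R) (w lambda : R) :
  smooth_on (trace_values w) f2 ->
  (forall T, trace_values w T -> f2 T = lambda * T) ->
  exists l, forall s, 0 < s -> Derive f2 (- s + 3 * (w * s)) = l.
Proof.
  intros hf2 e.
  destruct (Req_dec (3 * w - 1) 0) as [hw|hw].
  - exists (Derive f2 0); intros s _; f_equal.
    transitivity (s * (3 * w - 1)); [ring|]; rewrite hw; ring.
  - exists lambda; intros s hs.
    assert (h : is_derive (fun x => f2 (- x + 3 * (w * x))) s
                  ((3 * w - 1) * Derive f2 (- s + 3 * (w * s)))).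
    { apply (is_derive_comp f2 (fun x => - x + 3 * (w * x))).
      - apply Derive_correct, (smooth_on_ex_derive _ _ _ hf2).
        exists s; split; [exact hs | reflexivity].
      - auto_derive; [exact I | ring]. }
    apply is_derive_unique in h.
    rewrite (Derive_ext_pos _ (fun x => lambda * (3 * w - 1) * x)) in h.
    + replace (Derive _ s) with (lambda * (3 * w - 1)) in h
        by (symmetry; apply is_derive_unique; auto_derive; [exact I | ring]).
      apply (Rmult_eq_reg_l (3 * w - 1)); [lra | exact hw].
    + exact hs.
    + intros x hx; rewrite e by (exists x; split; [exact hx | reflexivity]); ring.
Qed.

(** * The equivalence *)

Lemma curvature_values_flrw (a1 r : R) :
  curvature_values a1 r <-> exists t, 0 < t /\ r = 6 * a1 * (2 * a1 - 1) / t ^ 2.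
Proof.
  split.
  - intros [p [hp ->]]; exists (p ct); split; [exact hp | apply curvature_flrw, hp].
  - intros [t [ht ->]]; exists (fun _ => t); split; [exact ht|].
    symmetry; apply (curvature_flrw a1 (fun _ => t)), ht.
Qed.

Theorem theorem1 (f1 f2 : R -> R) (a1 w : R)
  (ha1 : 0 < a1)
  (hf1 : smooth_on (curvature_values a1) f1)
  (hf2 : smooth_on (trace_values w) f2)
  (hF : forall r : R, curvature_values a1 r -> Derive f1 r <> 0) :
  admits_self_similar_solutions f1 f2 a1 w <->
  exists c n lambda : R,
    c <> 0 /\ n <> 0 /\
    (forall r : R, curvature_values a1 r -> f1 r = c * real_power r n) /\
    (forall T : R, trace_values w T -> f2 T = lambda * T).
Proof.
  set (r0 := 6 * a1 * (2 * a1 - 1)).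
  assert (hcv : forall t, 0 < t -> curvature_values a1 (r0 / t ^ 2)).
  { intros t ht; apply curvature_values_flrw; exists t; split; [exact ht | reflexivity]. }
  assert (hd1 : forall t, 0 < t -> ex_derive f1 (r0 / t ^ 2)).
  { intros t ht; apply (smooth_on_ex_derive _ _ _ hf1), hcv, ht. }
  assert (hF' : forall t, 0 < t -> Derive f1 (r0 / t ^ 2) <> 0).
  { intros t ht; apply hF, hcv, ht. }
  assert (hFp : forall p, 0 < p ct -> F_of f1 a1 p = Derive f1 (r0 / p ct ^ 2)).
  { intros p hp; unfold F_of; rewrite curvature_flrw by exact hp; reflexivity. }
  split.
  - intros [rho [hrho [hpos [_ hS]]]].
    assert (hdr : forall t, 0 < t -> ex_derive (fun s => r0 / s ^ 2) t).
    { intros t ht; eexists; apply is_derive_inverse_square, ht. }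
    assert (hdf : forall t, 0 < t -> ex_derive (fun s => f1 (r0 / s ^ 2)) t).
    { intros t ht; eexists; apply is_derive_along_inverse_square, hd1; exact ht. }
    assert (hdF : forall t, 0 < t -> ex_derive (fun s => / Derive f1 (r0 / s ^ 2)) t).
    { intros t ht; apply ex_derive_inv; [|apply hF', ht].
      eexists; apply is_derive_along_inverse_square; [exact ht|].
      apply (smooth_on_ex_derive_Derive _ _ _ hf1), hcv, ht. }
    assert (hdrho : forall t, 0 < t -> ex_derive rho t).
    { intros t ht; apply (smooth_on_ex_derive _ _ _ hrho ht). }
    (* The tt components of the first, third and sixth constituents control f_1/F, rho/F and f_2/F;
       the factor -1 is g_tt. *)
    assert (h1 := collineation_time_component a1 _
      (fun t => / 2 * (/ Derive f1 (r0 / t ^ 2) * f1 (r0 / t ^ 2) - r0 / t ^ 2) * (-1))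
      (hS _ (or_introl eq_refl))).
    assert (h3 := collineation_time_component a1 _
      (fun t => / Derive f1 (r0 / t ^ 2) * rho t)
      (hS _ (or_intror (or_intror (or_introl eq_refl))))).
    assert (h6 := collineation_time_component a1 _
      (fun t => / Derive f1 (r0 / t ^ 2) * f2 (trace w rho t) * (-1))
      (hS _ (or_intror (or_intror (or_intror (or_intror (or_intror
        (or_introl eq_refl)))))))).
    destruct h1 as [k1 h1].
    { intros p hp; rewrite hFp, curvature_flrw by exact hp; reflexivity. }
    { intros t ht; apply ex_derive_mult; [|apply ex_derive_const].
      apply ex_derive_scal.
      apply (ex_derive_minus (V := R_NormedModule)); [|apply hdr, ht].
      apply ex_derive_mult; [apply hdF, ht | apply hdf, ht]. }
    destruct h3 as [k3 h3].
    { intros p hp; rewrite hFp, fluid_flrw by exact hp; reflexivity. }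
    { intros t ht; apply ex_derive_mult; [apply hdF, ht | apply hdrho, ht]. }
    destruct h6 as [k6 h6].
    { intros p hp; rewrite hFp by exact hp; reflexivity. }
    { intros t ht; apply ex_derive_mult; [|apply ex_derive_const].
      apply ex_derive_mult; [apply hdF, ht|].
      apply (ex_derive_comp f2 (trace w rho)).
      - apply (smooth_on_ex_derive _ _ _ hf2).
        exists (rho t); split; [apply hpos, ht | reflexivity].
      - apply (ex_derive_plus (V := R_NormedModule) (fun s => - rho s)).
        + apply (ex_derive_opp (V := R_NormedModule)), hdrho, ht.
        + apply ex_derive_scal, ex_derive_scal, hdrho, ht. }
    assert (hk3 : k3 <> 0).
    { intros ->; specialize (h3 1 Rlt_0_1); specialize (hpos 1 Rlt_0_1).
      specialize (hF' 1 Rlt_0_1); simpl in *.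
      unfold Rdiv in h3 at 2; rewrite Rmult_0_l in h3.
      apply Rmult_integral in h3; destruct h3 as [h|h]; [|lra].
      revert h; apply Rinv_neq_0_compat, hF'. }
    assert (hr : forall t, 0 < t -> rho t = k3 * Derive f1 (r0 / t ^ 2) / t ^ 2).
    { intros t ht; specialize (hF' t ht).
      transitivity (Derive f1 (r0 / t ^ 2) * (/ Derive f1 (r0 / t ^ 2) * rho t)).
      - field; assumption.
      - rewrite h3 by exact ht; field; lra. }
    assert (hf : forall t, 0 < t -> f2 (trace w rho t) = - k6 / k3 * rho t).
    { intros t ht; rewrite hr by exact ht; specialize (hF' t ht).
      transitivity (- Derive f1 (r0 / t ^ 2) *
        (/ Derive f1 (r0 / t ^ 2) * f2 (trace w rho t) * (-1))).
      - field; assumption.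
      - rewrite h6 by exact ht; field; lra. }
    assert (h1' : forall t, 0 < t ->
      f1 (r0 / t ^ 2) = (r0 - 2 * k1) / t ^ 2 * Derive f1 (r0 / t ^ 2)).
    { intros t ht; specialize (hF' t ht).
      transitivity (Derive f1 (r0 / t ^ 2) * (r0 / t ^ 2 - 2 *
        (/ 2 * (/ Derive f1 (r0 / t ^ 2) * f1 (r0 / t ^ 2) - r0 / t ^ 2) * (-1)))).
      - field; split; lra.
      - rewrite h1 by exact ht; field; lra. }
    (* Both signs of R_0 and the case R_0 = 0 deliver the same data: the law for f_1 and a density K
       t^m with m <> 0. *)
    assert (hmain : exists c n m K, c <> 0 /\ n <> 0 /\
      (forall r, curvature_values a1 r -> f1 r = c * real_power r n) /\
      m <> 0 /\ forall t, 0 < t -> rho t = K * Rpower t m).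
    { destruct (Req_dec r0 0) as [hr0|hr0].
      - assert (h0 : forall t, r0 / t ^ 2 = 0).
        { intros t; rewrite hr0; unfold Rdiv; ring. }
        exists 1, 1, (0 - 2), (k3 * Derive f1 0); repeat split; try lra.
        + intros r hrv; apply curvature_values_flrw in hrv; destruct hrv as [t [ht ->]].
          fold r0; rewrite h0; unfold real_power.
          destruct (Req_EM_T 0 0) as [_|ne]; [|contradiction].
          (* At times 1 and 2 the same value f_1(0) equals q F and q F / 4 with the same q and F, so
             it is 0, as is [real_power 0 n]. *)
          pose proof (h1' 1 Rlt_0_1) as e1; pose proof (h1' 2 Rlt_0_2) as e2.
          rewrite h0 in e1, e2; lra.
        + intros s hs; rewrite hr, h0, Rpower_minus2, Rpower_O by exact hs.
          field; lra.
      - destruct (power_law_of_first_constituent f1 r0 (r0 - 2 * k1) hr0 hd1 hF' h1')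
          as [c [n [hc [hn e]]]].
        pose proof (Rpower_pos (Rabs r0) n) as hp.
        (* Dividing by |R_0|^n passes from a coefficient of t^(-2n) to one of |R|^n. The density
           exponent is that of F, 2 - 2n, lowered by 2. *)
        exists (c / Rpower (Rabs r0) n), n, (2 - 2 * n - 2), (k3 * (c * n / r0)).
        repeat split; try lra.
        + apply Rmult_integral_contrapositive_currified; [exact hc|].
          apply Rinv_neq_0_compat; lra.
        + intros r hrv; apply curvature_values_flrw in hrv; destruct hrv as [t [ht ->]].
          fold r0; rewrite e, real_power_inverse_square by assumption; field; lra.
        + intros t ht; rewrite hr, Rpower_minus2 by exact ht.
          rewrite (Derive_of_power_law f1 r0 c n t hr0 ht (hd1 t ht) e).
          field; split; lra. }
    destruct hmain as [c [n [m [K [hc [hn [hf1n [hm hrm]]]]]]]].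
    assert (hK : 0 < K).
    { specialize (hpos 1 Rlt_0_1); rewrite hrm in hpos by lra.
      pose proof (Rpower_pos 1 m); apply Rmult_lt_reg_r with (Rpower 1 m); lra. }
    destruct (linear_of_power_density f2 rho w m K _ hm hK hrm hf) as [lambda hl].
    exists c, n, lambda; repeat split; assumption.
  - intros [c [n [lambda [hc [hn [hf1n hl]]]]]].
    destruct (Derive_of_linear f2 w lambda hf2 hl) as [l hl'].
    assert (h2 : forall s, 0 < s ->
      f2 (- s + 3 * (w * s)) = lambda * (3 * w - 1) * s).
    { intros s hs; rewrite hl by (exists s; split; [exact hs | reflexivity]); ring. }
    destruct (Req_dec r0 0) as [hr0|hr0].
    + assert (h0 : forall t, r0 / t ^ 2 = 0).
      { intros t; rewrite hr0; unfold Rdiv; ring. }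
      (* With R = 0 throughout, F is the constant f_1'(0), so b = 0, and f_1(0) = 0 gives c = 0. *)
      apply (power_law_admits f1 f2 a1 w 0 (Derive f1 0) 0 (lambda * (3 * w - 1)) l);
        [| | |exact h2|exact hl'].
      * pose proof (hF' 1 Rlt_0_1) as h; rewrite h0 in h; exact h.
      * intros p hp; rewrite hFp, h0, Rpower_O by exact hp; ring.
      * intros p hp; rewrite hf1n by (exists p; split; [exact hp | reflexivity]).
        rewrite curvature_flrw by exact hp; fold r0; rewrite h0; unfold real_power.
        destruct (Req_EM_T 0 0) as [_|ne]; [ring | contradiction].
    + pose proof (Rpower_pos (Rabs r0) n) as hp0.
      assert (e : forall t, 0 < t ->
        f1 (r0 / t ^ 2) = c * Rpower (Rabs r0) n * Rpower t (- 2 * n)).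
      { intros t ht; rewrite hf1n by (apply hcv, ht).
        rewrite real_power_inverse_square by assumption; ring. }
      (* The exponent and coefficient of F are those found by [Derive_of_power_law]; the coefficient
         is nonzero because c, n and R_0 are. *)
      apply (power_law_admits f1 f2 a1 w (2 - 2 * n)
        (c * Rpower (Rabs r0) n * n / r0) (c * Rpower (Rabs r0) n)
        (lambda * (3 * w - 1)) l); [| | |exact h2|exact hl'].
      * repeat apply Rmult_integral_contrapositive_currified; try assumption; try lra.
        apply Rinv_neq_0_compat, hr0.
      * intros p hp; rewrite hFp by exact hp.
        apply Derive_of_power_law; trivial; apply hd1, hp.
      * intros p hp; rewrite curvature_flrw by exact hp; fold r0.
        rewrite e by exact hp; do 2 f_equal; ring.
Qed.
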